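(* Let $L$ and $L'$ be Lie algebras over $\mathbb{F}_2$ and let $\phi:L'\to L$ be a Lie algebra homomorphism, regarded as a homomorphism of $L_\infty$-algebras with $\phi_1=\phi$ and $\phi_i=0$ for $i\ne1$. Then $\phi^*$ is the usual restriction of scalars for Lie algebra representations. That is, if $M$ is a representation of $L$, regarded as an $L_\infty$-module over $L$, then $\phi^*M$ is the representation of $L'$ on $M$ given by $x\cdot m=\phi(x)\cdot m$ for $x\in L'$, $m\in M$ (regarded as an $L_\infty$-module over $L'$), and if $f:M\to N$ is a homomorphism of representations of $L$, regarded as an $L_\infty$-module homomorphism, then $\phi^*f$ is the same linear map $f$, regarded as a homomorphism of representations of $L'$.
   Context: All vector spaces are graded and over $\mathbb{F}_2$; no signs appear. A Lie algebra is regarded as an $L_\infty$-algebra concentrated in degree $0$, with $l_2=[\cdot,\cdot]$ and $l_k=0$ for $k\ne2$. A representation $M$ of a Lie algebra $L$ is regarded as an $L_\infty$-module over $L$ concentrated in degree $0$, with structure maps $k_n:L^{\otimes(n-1)}\otimes M\to M$ given by $k_2(x,m)=x\cdot m$ and $k_n=0$ for $n\neq2$. A homomorphism $f$ of representations is regarded as an $L_\infty$-module homomorphism $\{f_n\}$ with $f_1=f$ and $f_n=0$ for $n\ge2$. For $\tau\in S_n$, $\tau^\bullet$ sends $x_1\otimes\cdots\otimes x_n$ to $x_{\tau(1)}\otimes\cdots\otimes x_{\tau(n)}$. For integers $i_1,\ldots,i_r\ge1$ with sum $n$, $S'(i_1,\ldots,i_r)\subset S_n$ is empty unless $i_1\le\cdots\le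 i_r$, and otherwise consists of the permutations $\tau$ that are increasing on each of the consecutive blocks of positions of sizes $i_1,\ldots,i_r$ and satisfy $\tau(i_1+\cdots+i_{l-1}+1)<\tau(i_1+\cdots+i_l+1)$ whenever $i_l=i_{l+1}$. For a homomorphism of $L_\infty$-algebras $I=\{I_n:(L')^{\otimes n}\to L\}$, the restriction of scalars functor $I^*$ from $L_\infty$-modules over $L$ to $L_\infty$-modules over $L'$ is defined by $I^*(M,k)=(M,k')$ with $k_1'=k_1$ and, for $n\ge2$, $$k_n'=\sum_{r=1}^{n-1}\ \sum_{\substack{i_1+\cdots+i_r=n-1\\ \tau\in S'(i_1,\ldots,i_r)}} k_{r+1}\circ(I_{i_1}\otimes\cdots\otimes I_{i_r}\otimes \mathrm{Id})\circ(\tau^\bullet\otimes\mathrm{Id}),$$ and on an $L_\infty$-module homomorphism $f=\{f_n:L^{\otimes(n-1)}\otimes M\to N\}$ by $(I^*f)_1=f_1$ and, for $n\ge2$, $$(I^*f)_n=\sum_{r=1}^{n-1}\ \sum_{\substack{i_1+\cdots+i_r=n-1\\ \tau\in S'(i_1,\ldots,i_r)}} f_{r+1}\circ(I_{i_1}\otimes\cdots\otimes I_{i_r}\otimes \mathrm{Id})\circ(\tau^\bullet\otimes\mathrm{Id}).$$ *)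

(* Defs.v *)
From HB Require Import structures.
From mathcomp Require Import all_boot all_order all_fingroup all_algebra.

Set Implicit Arguments.
Unset Strict Implicit.
Unset Printing Implicit Defensive.

Import GRing.Theory.
Local Open Scope ring_scope.

(* A graded space is its total space together with the subspaces of
   homogeneous elements, of which it is the (internal) direct sum. *)
Record gradedSpace := GradedSpace {
  gcarrier :> lmodType 'F_2;
  grade : int -> gcarrier -> Prop;
  grade_lin : forall d a u v, grade d u -> grade d v -> grade d (a *: u + v);
  grade_zero : forall d, grade d 0;
  grade_span : forall v, exists (ds : seq int) (c : int -> gcarrier),
    [/\ uniq ds, forall d, grade d (c d) & v = \sum_(d <- ds) c d];
  grade_indep : forall (ds : seq int) (c : int -> gcarrier),
    uniq ds -> (forall d, grade d (c d)) -> \sum_(d <- ds) c d = 0 ->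
    forall d, d \in ds -> c d = 0
}.

(* Convention for multilinear maps.  A family of maps g_n : V^{(x) n} -> W,
   n >= 0, is a single function g : seq V -> W, whose restriction to the
   sequences of size n is g_n, evaluated on pure tensors. *)

Definition multilinear (V W : lmodType 'F_2) (g : seq V -> W) : Prop :=
  forall s1 s2, linear (fun x => g (s1 ++ x :: s2)).

(* No sign appears in characteristic 2. *)
Definition symmetric_family (V W : lmodType 'F_2) (g : seq V -> W) : Prop :=
  forall s t, perm_eq s t -> g s = g t.

Definition homogeneous (V : gradedSpace) (ds : seq int) (s : seq V) : Prop :=
  size ds = size s /\ forall i, (i < size s)%N -> grade ds`_i s`_i.

(* Positions and values are numbered from 0. *)
Definition oneline n (tau : 'S_n) : seq nat :=
  [seq nat_of_ord (tau j) | j <- enum 'I_n].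

Definition tensor_perm (V : lmodType 'F_2) n (s : seq V) (tau : 'S_n) : seq V :=
  [seq s`_(tau j) | j <- enum 'I_n].

Definition unshuffle n (j : nat) (tau : 'S_n) : bool :=
  sorted ltn (take j (oneline tau)) && sorted ltn (drop j (oneline tau)).

(* [sumn (take l i)] is the first position of block number l. *)
Definition Sprime n (i : seq nat) (tau : 'S_n) : bool :=
  [&& sorted leq i,
      all (sorted ltn) (reshape i (oneline tau)) &
      [forall l : 'I_(size i).-1,
        (nth 0 i l == nth 0 i l.+1)%N ==>
        (nth 0 (oneline tau) (sumn (take l i)) <
         nth 0 (oneline tau) (sumn (take l.+1 i)))%N]].

Definition composition n (i : seq nat) : bool := all (leq 1) i && (sumn i == n).

(* Sum over the unshuffles of type (j, size s - j); F receives the two blocks. *)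
Definition unshuffle_sum (V W : lmodType 'F_2) (s : seq V) (j : nat)
    (F : seq V -> seq V -> W) : W :=
  \sum_(tau : 'S_(size s) | unshuffle j tau)
    F (take j (tensor_perm s tau)) (drop j (tensor_perm s tau)).

(* Sum over r, over i_1 + ... + i_r = size s with all i_l >= 1, and over
   tau in S'(i_1, ..., i_r); F receives the r consecutive blocks of the
   permuted tensor, so that [map I] of them is (I_{i_1} (x) ... (x) I_{i_r}). *)
Definition Sprime_sum (V W : lmodType 'F_2) (s : seq V)
    (F : seq (seq V) -> W) : W :=
  \sum_(1 <= r < (size s).+1)
    \sum_(i : r.-tuple 'I_(size s).+1 | composition (size s) (map val i))
      \sum_(tau : 'S_(size s) | Sprime (map val i) tau)
        F (reshape (map val i) (tensor_perm s tau)).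

(* [lop s] is l_n for n = size s, of degree n - 2; there is no l_0. *)
Record linfAlgebra := LinfAlgebra {
  lspace :> gradedSpace;
  lop : seq lspace -> lspace;
  lop_nil : lop [::] = 0;
  lop_multilinear : multilinear lop;
  lop_symmetric : symmetric_family lop;
  lop_degree : forall ds s, homogeneous ds s ->
    grade (\sum_(d <- ds) d + (size s)%:Z - 2) (lop s);
  lop_jacobi : forall s,
    \sum_(1 <= j < (size s).+1)
      unshuffle_sum s j (fun u v => lop (lop u :: v)) = 0
}.

(* [hop s] is I_n for n = size s, of degree n - 1; there is no I_0. *)
Record linfHom (L' L : linfAlgebra) := LinfHom {
  hop :> seq L' -> L;
  hop_nil : hop [::] = 0;
  hop_multilinear : multilinear hop;
  hop_symmetric : symmetric_family hop;
  hop_degree : forall ds s, homogeneous ds s ->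
    grade (\sum_(d <- ds) d + (size s)%:Z - 1) (hop s);
  hop_relation : forall s,
    \sum_(1 <= j < (size s).+1)
      unshuffle_sum s j (fun u v => hop (lop u :: v)) =
    Sprime_sum s (fun bs => lop (map hop bs))
}.

(* A graded space with structure maps: [kop s m] is k_n (s (x) m) for
   n = size s + 1. *)
Record linfModuleData (L : linfAlgebra) := LinfModuleData {
  kspace :> gradedSpace;
  kop : seq L -> kspace -> kspace
}.

(* k_n has degree n - 2. *)
Record is_linfModule (L : linfAlgebra) (M : linfModuleData L) : Prop :=
  IsLinfModule {
  kop_linear : forall s, linear (@kop L M s);
  kop_multilinear : forall m, multilinear (fun s => @kop L M s m);
  kop_symmetric : forall m, symmetric_family (fun s => @kop L M s m);
  kop_degree : forall ds s e (m : M), homogeneous ds s -> grade e m ->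
    grade (\sum_(d <- ds) d + e + (size s)%:Z - 1) (kop s m);
  kop_relation : forall s (m : M),
    \sum_(1 <= j < (size s).+1)
      unshuffle_sum s j (fun u v => kop (lop u :: v) m) +
    \sum_(0 <= j < (size s).+1)
      unshuffle_sum s j (fun u v => kop v (kop u m)) = 0
}.

Record linfModule (L : linfAlgebra) := LinfModule {
  kdata :> linfModuleData L;
  kdataP : is_linfModule kdata
}.

(* [fop s m] is f_n (s (x) m) for n = size s + 1, of degree n - 1. *)
Record linfModuleHom (L : linfAlgebra) (M N : linfModule L) := LinfModuleHom {
  fop :> seq L -> M -> N;
  fop_linear : forall s, linear (fop s);
  fop_multilinear : forall m, multilinear (fop^~ m);
  fop_symmetric : forall m, symmetric_family (fop^~ m);
  fop_degree : forall ds s e (m : M), homogeneous ds s -> grade e m ->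
    grade (\sum_(d <- ds) d + e + (size s)%:Z) (fop s m);
  fop_relation : forall s (m : M),
    \sum_(1 <= j < (size s).+1)
      unshuffle_sum s j (fun u v => fop (lop u :: v) m) +
    \sum_(0 <= j < (size s).+1)
      unshuffle_sum s j (fun u v => fop v (kop u m)) =
    \sum_(0 <= j < (size s).+1)
      unshuffle_sum s j (fun u v => kop v (fop u m))
}.

(* The case [::] is n = 1.  The result consists of the structure maps k'_n;
   that they satisfy the module relations in general is not established here. *)
Definition restrict (L' L : linfAlgebra) (I : linfHom L' L) (M : linfModule L) :
    linfModuleData L' :=
  @LinfModuleData L' M (fun s m =>
    if s is [::] then kop [::] m
    else Sprime_sum s (fun bs => kop (map I bs) m)).

Definition restrict_hom (L' L : linfAlgebra) (I : linfHom L' L)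
    (M N : linfModule L) (f : linfModuleHom M N) :
    seq L' -> restrict I M -> restrict I N :=
  fun s m =>
    if s is [::] then f [::] m
    else Sprime_sum s (fun bs => f (map I bs) m).

Arguments restrict_hom {L' L} I {M N} f s m.

Record lieAlgebra := LieAlgebra {
  lie_space :> lmodType 'F_2;
  bracket : lie_space -> lie_space -> lie_space;
  bracket_linear_l : forall y, linear (bracket^~ y);
  bracket_linear_r : forall x, linear (bracket x);
  bracket_alt : forall x, bracket x x = 0;
  bracket_jacobi : forall x y z,
    bracket x (bracket y z) + bracket y (bracket z x) +
    bracket z (bracket x y) = 0
}.

Record lieHom (L' L : lieAlgebra) := LieHom {
  lie_map :> {linear L' -> L};
  lie_map_bracket : forall x y,
    lie_map (bracket x y) = bracket (lie_map x) (lie_map y)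
}.

Record lieRep (L : lieAlgebra) := LieRep {
  rep_space :> lmodType 'F_2;
  act : L -> rep_space -> rep_space;
  act_linear_l : forall m, linear (act^~ m);
  act_linear_r : forall x, linear (act x);
  act_bracket : forall x y m,
    act (bracket x y) m = act x (act y m) - act y (act x m)
}.

Record repHom (L : lieAlgebra) (M N : lieRep L) := RepHom {
  rep_map :> {linear M -> N};
  rep_map_act : forall x m, rep_map (act x m) = act x (rep_map m)
}.

Definition rep_restrict (L' L : lieAlgebra) (phi : lieHom L' L)
  (M : lieRep L) : lieRep L'.
Proof.
refine (@LieRep L' M (fun x m => act (phi x) m) _ _ _).
- by move=> m a x y; rewrite linearP (act_linear_l m).
- by move=> x; exact: act_linear_r.
- by move=> x y m; rewrite lie_map_bracket act_bracket.
Defined.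

Definition repHom_restrict (L' L : lieAlgebra) (phi : lieHom L' L)
  (M N : lieRep L) (f : repHom M N) :
  repHom (rep_restrict phi M) (rep_restrict phi N) :=
  @RepHom L' (rep_restrict phi M) (rep_restrict phi N) (rep_map f)
    (fun x m => rep_map_act f (phi x) m).

Definition deg0 (V : lmodType 'F_2) : gradedSpace.
Proof.
refine (@GradedSpace V (fun d v => d = 0 \/ v = 0) _ _ _ _).
- move=> d a u v [->|->] [d0|->]; try by left.
  by right; rewrite scaler0 addr0.
- by move=> d; right.
- move=> v; exists [:: 0], (fun d => if d == 0 then v else 0); split=> //.
    by move=> d; case: eqP; [left | right].
  by rewrite big_seq1 eqxx.
- move=> ds c ds_uniq cP sum0 d d_in.
  case: (cP d) => // d0; subst d; rewrite -sum0.
  rewrite (bigD1_seq 0) //= big1 ?addr0 // => e /eqP e0.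
  by case: (cP e).
Defined.

Lemma addvv_F2 (V : lmodType 'F_2) (v : V) : v + v = 0.
Proof. by rewrite -[v]scale1r -scalerDl (_ : 1 + 1 = 0) ?scale0r //; apply/val_inj. Qed.

Lemma bracketC (L : lieAlgebra) (x y : L) : bracket x y = bracket y x.
Proof.
have addl a b c : bracket (a + b) c = bracket a c + bracket b c :> L.
  by have := bracket_linear_l c 1 a b; rewrite !scale1r.
have addr a b c : bracket c (a + b) = bracket c a + bracket c b :> L.
  by have := bracket_linear_r c 1 a b; rewrite !scale1r.
have := bracket_alt (x + y).
rewrite addl !addr !bracket_alt add0r addr0 => /(congr1 (+%R^~ (bracket y x))).
by rewrite -addrA addvv_F2 addr0 add0r.
Qed.

Lemma linear_at0 (V W : lmodType 'F_2) (g : V -> W) : linear g -> g 0 = 0.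
Proof. by move=> gP; have := gP (-1) 0 0; rewrite !scaleN1r oppr0 addr0 addNr. Qed.

Lemma mem_oneline_perms n (w : seq nat) :
  (w \in [seq oneline tau | tau : 'S_n]) = (w \in permutations (iota 0 n)).
Proof.
rewrite mem_permutations; apply/idP/idP.
  case/imageP=> tau _ ->; apply: uniq_perm.
  - rewrite map_inj_uniq ?enum_uniq // => i j /val_inj; exact: perm_inj.
  - exact: iota_uniq.
  move=> k; rewrite mem_iota add0n /=; apply/mapP/idP=> [[i _ ->] //|lt_kn].
  by exists (tau^-1%g (Ordinal lt_kn)); rewrite ?mem_enum ?permKV.
move=> w_perm; have sz_w : size w = n by rewrite (perm_size w_perm) size_iota.
have lt_w (i : 'I_n) : (nth 0 w i < n)%N.
  have : nth 0%N w i \in w by rewrite mem_nth // sz_w.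
  by rewrite (perm_mem w_perm) mem_iota.
have inj_w : injective (fun i => Ordinal (lt_w i)).
  move=> i j [/eqP]; rewrite nth_uniq ?sz_w // ?(perm_uniq w_perm) ?iota_uniq //.
  by move/eqP/val_inj.
apply/imageP; exists (perm inj_w) => //; apply: (@eq_from_nth _ 0%N).
  by rewrite size_map size_enum_ord.
move=> i; rewrite sz_w => lt_in.
rewrite (@nth_map _ (Ordinal lt_in) _ _ _ _ (enum 'I_n)) ?size_enum_ord //.
by rewrite permE /= nth_enum_ord.
Qed.

Lemma oneline_inj n : injective (@oneline n).
Proof.
move=> s t st; apply/permP=> i; apply/val_inj.
have: nth 0%N (oneline s) i = nth 0%N (oneline t) i by rewrite st.
by rewrite !(@nth_map _ i _ _ _ _ (enum 'I_n)) ?size_enum_ord // !nth_ord_enum.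
Qed.

Lemma tensor_permE (V : lmodType 'F_2) n (s : seq V) (tau : 'S_n) :
  tensor_perm s tau = [seq s`_k | k <- oneline tau].
Proof. by rewrite /oneline -map_comp. Qed.

Lemma sum_oneline (W : lmodType 'F_2) n (P : pred (seq nat)) (F : seq nat -> W) :
  \sum_(tau : 'S_n | P (oneline tau)) F (oneline tau) =
  \sum_(w <- permutations (iota 0 n) | P w) F w.
Proof.
rewrite -(big_map (@oneline n) P F) /=; apply: perm_big; apply: uniq_perm.
- by rewrite map_inj_uniq ?index_enum_uniq //; exact: oneline_inj.
- exact: permutations_uniq.
move=> w; rewrite -mem_oneline_perms; apply/mapP/imageP.
  by case=> t _ ->; exists t.
by case=> t _ ->; exists t => //; rewrite mem_index_enum.
Qed.

Lemma size_tensor_perm (V : lmodType 'F_2) n (s : seq V) (tau : 'S_n) :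
  size (tensor_perm s tau) = n.
Proof. by rewrite size_map size_enum_ord. Qed.

Lemma unshuffle_sumE (V W : lmodType 'F_2) (s : seq V) j
    (F : seq V -> seq V -> W) :
  unshuffle_sum s j F =
  \sum_(w <- permutations (iota 0 (size s)) |
          sorted ltn (take j w) && sorted ltn (drop j w))
    F [seq s`_k | k <- take j w] [seq s`_k | k <- drop j w].
Proof.
rewrite -(sum_oneline _ (fun w => sorted ltn (take j w) && sorted ltn (drop j w))
  (fun w => F [seq s`_k | k <- take j w] [seq s`_k | k <- drop j w])).
by apply: eq_bigr => tau _; rewrite tensor_permE map_take map_drop.
Qed.

Lemma perms1 : permutations (iota 0 1) =
  ltac:(let t := eval vm_compute in (permutations (iota 0 1)) in exact t).
Proof. by []. Qed.

Lemma perms2 : permutations (iota 0 2) =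
  ltac:(let t := eval vm_compute in (permutations (iota 0 2)) in exact t).
Proof. by []. Qed.

Lemma perms3 : permutations (iota 0 3) =
  ltac:(let t := eval vm_compute in (permutations (iota 0 3)) in exact t).
Proof. by []. Qed.

Lemma unshuffle_sum_size1 (V W : lmodType 'F_2) (x : V)
    (F : seq V -> seq V -> W) :
  \sum_(0 <= j < (size [:: x]).+1) unshuffle_sum [:: x] j F =
  F [::] [:: x] + F [:: x] [::].
Proof.
rewrite big_ltn // big_ltn // big_geq // !unshuffle_sumE [size _]/= perms1.
by rewrite !big_cons !big_nil /= !addr0.
Qed.

Lemma unshuffle_sum_size2 (V W : lmodType 'F_2) (x y : V)
    (F : seq V -> seq V -> W) :
  \sum_(1 <= j < (size [:: x; y]).+1) unshuffle_sum [:: x; y] j F =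
  F [:: x] [:: y] + F [:: y] [:: x] + F [:: x; y] [::].
Proof.
rewrite big_ltn // big_ltn // big_geq // !unshuffle_sumE [size _]/= perms2.
rewrite !big_cons !big_nil /= !addr0 ?add0r.
by rewrite ?addrA; congr (_ + _); exact: addrC.
Qed.

Lemma unshuffle_sum_size2' (V W : lmodType 'F_2) (x y : V)
    (F : seq V -> seq V -> W) :
  \sum_(0 <= j < (size [:: x; y]).+1) unshuffle_sum [:: x; y] j F =
  F [::] [:: x; y] + (F [:: x] [:: y] + F [:: y] [:: x] + F [:: x; y] [::]).
Proof.
rewrite -unshuffle_sum_size2 big_ltn //; congr (_ + _).
rewrite unshuffle_sumE [size _]/= perms2.
by rewrite !big_cons !big_nil /= !addr0 ?add0r.
Qed.

Lemma unshuffle_sum_size3 (V W : lmodType 'F_2) (x y z : V)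
    (F : seq V -> seq V -> W) :
  \sum_(1 <= j < (size [:: x; y; z]).+1) unshuffle_sum [:: x; y; z] j F =
  F [:: x] [:: y; z] + F [:: y] [:: x; z] + F [:: z] [:: x; y] +
  (F [:: x; y] [:: z] + F [:: x; z] [:: y] + F [:: y; z] [:: x]) +
  F [:: x; y; z] [::].
Proof.
rewrite big_ltn // big_ltn // big_ltn // big_geq // !unshuffle_sumE.
rewrite [size _]/= perms3 !big_cons !big_nil /= !addr0 ?add0r.
by rewrite !addrA [in LHS](addrC (F [:: y] [:: x; z])).
Qed.

Lemma unshuffle_sum_eq0 (V W : lmodType 'F_2) (a : nat) (s : seq V)
    (F : seq V -> seq V -> W) :
  (forall u v, (size u + size v)%N = size s -> F u v = 0) ->
  \sum_(a <= j < (size s).+1) unshuffle_sum s j F = 0.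
Proof.
move=> F0; rewrite big_nat big1 // => j /andP[_ j_lt].
rewrite /unshuffle_sum big1 // => tau _; apply: F0.
by rewrite -size_cat cat_take_drop size_tensor_perm.
Qed.

Lemma Sprime_sum_eq0 (V W : lmodType 'F_2) (s : seq V)
    (F : seq (seq V) -> W) (c : nat) :
  (forall bs, size bs <> c -> F bs = 0) ->
  (forall bs b, size bs = c -> b \in bs -> size b <> 1%N -> F bs = 0) ->
  size s <> c -> Sprime_sum s F = 0.
Proof.
move=> Fc F1 sc; rewrite /Sprime_sum big1 // => r _; rewrite big1 // => i.
case/andP=> i_pos /eqP i_sum; rewrite big1 // => tau _.
have sz : sumn (map val i) = size (tensor_perm s tau).
  by rewrite size_tensor_perm.
set bs := reshape _ _; have shape_bs : shape bs = map val i.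
  by rewrite reshapeKl // sz.
have [szc|/eqP szc] := eqVneq (size bs) c; last exact: Fc.
case: (boolP (all (fun b => size b == 1%N) bs)) => [all1|/allPn[b b_in /eqP b1]].
  case: sc; rewrite -i_sum -shape_bs -szc; elim: (bs) all1 => //= b l IHl.
  by case/andP=> /eqP -> /IHl ->.
exact: (F1 _ b).
Qed.


Lemma homogeneous_cons (V : gradedSpace) ds (x : V) s :
  homogeneous ds (x :: s) ->
  exists d ds', [/\ ds = d :: ds', grade d x & homogeneous ds' s].
Proof.
case: ds => [|d ds'] [] //= [sz] h; exists d, ds'; split=> //.
  exact: (h 0%N).
by split=> // i i_lt; exact: (h i.+1).
Qed.

Lemma homogeneous_nil (V : gradedSpace) ds :
  homogeneous (ds : seq int) ([::] : seq V) -> ds = [::].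
Proof. by case: ds => [|d ds'] []. Qed.

Lemma forall_ord1 (P : pred 'I_1) : [forall l, P l] = P ord0.
Proof. by apply/forallP/idP => [// | P0 l]; rewrite ord1. Qed.

Lemma size_reshape_tuple (V : lmodType 'F_2) r n (i : r.-tuple 'I_n) (s : seq V) :
  size (reshape (map val i) s) = r.
Proof. by rewrite size_reshape size_map size_tuple. Qed.

Lemma compositions2 (r : nat) (i : r.-tuple 'I_3) :
  composition 2 (map val i) ->
  map val i = [:: 2]%N \/ map val i = [:: 1; 1]%N.
Proof.
case: i => i /= _; rewrite /composition; move: (map _ i) => {i}.
case=> [|[|[|[|a]]] [|[|[|b]] [|[|c] l]]] //=;
  try by [left | right].
all: rewrite ?addSn ?addnS ?add0n ?andbF //=.
Qed.

Lemma Sprime_sum_size2 (V W : lmodType 'F_2) (x y : V)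
    (F : seq (seq V) -> W) :
  (forall bs, size bs <> 2%N -> F bs = 0) ->
  Sprime_sum [:: x; y] F = F [:: [:: x]; [:: y]].
Proof.
move=> F0; rewrite /Sprime_sum [size _]/= big_ltn // big_ltn // big_geq //.
rewrite addr0 big1 ?add0r; last first.
  move=> i _; rewrite big1 // => tau _; apply: F0.
  by rewrite size_reshape_tuple.
pose i0 : 2.-tuple 'I_3 := [tuple inord 1; inord 1].
have i0E : map val i0 = [:: 1; 1]%N by rewrite /= !inordK.
rewrite (bigD1 i0) /=; last by rewrite !inordK.
rewrite [X in _ + X]big1 ?addr0; last first.
  move=> i /andP[/compositions2[i_eq|i_eq] /eqP[]].
    by have := congr1 size i_eq; rewrite size_map size_tuple.
  by apply/val_inj/(inj_map val_inj); rewrite i0E.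
rewrite !inordK //.
under eq_bigr => tau _ do rewrite tensor_permE.
rewrite (sum_oneline 2 (fun w =>
  [&& sorted leq [:: 1; 1]%N, all (sorted ltn) (reshape [:: 1; 1]%N w) &
    [forall l : 'I_1, (nth 0 [:: 1; 1] l == nth 0 [:: 1; 1] l.+1)%N ==>
      (nth 0 w (sumn (take l [:: 1; 1])) <
       nth 0 w (sumn (take l.+1 [:: 1; 1])))%N]])
  (fun w => F (reshape [:: 1; 1]%N [seq [:: x; y]`_k | k <- w]))).
by rewrite perms2 !big_cons big_nil !forall_ord1 /= addr0.
Qed.

Lemma linear_cst0 (V W : lmodType 'F_2) : linear (fun _ : V => 0 : W).
Proof. by move=> a x y; rewrite scaler0 addr0. Qed.

Definition lie_op (L : lieAlgebra) (s : seq L) : L :=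
  if s is [:: x; y] then bracket x y else 0.

Definition lieHom_op (L' L : lieAlgebra) (phi : lieHom L' L) (s : seq L') : L :=
  if s is [:: x] then phi x else 0.

Definition rep_op (L : lieAlgebra) (M : lieRep L) (s : seq L) (m : M) : M :=
  if s is [:: x] then act x m else 0.

Definition repHom_op (L : lieAlgebra) (M N : lieRep L) (f : repHom M N)
    (s : seq L) (m : M) : N :=
  if s is [::] then f m else 0.

Lemma lie_op_eq0 (L : lieAlgebra) (s : seq L) : size s <> 2%N -> lie_op s = 0.
Proof. by case: s => [|x [|y [|z s]]]. Qed.

Lemma bracket0l (L : lieAlgebra) (x : L) : bracket 0 x = 0.
Proof. exact: (linear_at0 (bracket_linear_l x)). Qed.

Lemma bracket0r (L : lieAlgebra) (x : L) : bracket x 0 = 0.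
Proof. exact: (linear_at0 (bracket_linear_r x)). Qed.

Lemma act0l (L : lieAlgebra) (M : lieRep L) (m : M) : act 0 m = 0.
Proof. exact: (linear_at0 (act_linear_l m)). Qed.

Lemma act0r (L : lieAlgebra) (M : lieRep L) (x : L) : act x (0 : M) = 0.
Proof. exact: (linear_at0 (act_linear_r x)). Qed.

Lemma multilinear_unary (V W : lmodType 'F_2) (g : V -> W) : linear g ->
  multilinear (fun s => if s is [:: x] then g x else 0).
Proof.
by move=> g_lin [|a [|b s1]] [|c s2]; try exact: linear_cst0; exact: g_lin.
Qed.

Lemma symmetric_unary (V W : lmodType 'F_2) (g : V -> W) :
  symmetric_family (fun s => if s is [:: x] then g x else 0).
Proof.
move=> s t st; case: s st (perm_size st) => [|x [|y s]];
  case: t => [|x' [|y' t]] // st _.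
by move/perm_mem/(_ x): st; rewrite !inE eqxx => /esym/eqP ->.
Qed.

Lemma multilinear_binary (V W : lmodType 'F_2) (g : V -> V -> W) :
  (forall x, linear (g x)) -> (forall y, linear (g^~ y)) ->
  multilinear (fun s => if s is [:: x; y] then g x y else 0).
Proof.
move=> gr gl [|a [|b [|e s1]]] [|c [|d s2]]; try exact: linear_cst0.
- exact: gl.
- exact: gr.
Qed.

Lemma symmetric_binary (V W : lmodType 'F_2) (g : V -> V -> W) :
  (forall x y, g x y = g y x) ->
  symmetric_family (fun s => if s is [:: x; y] then g x y else 0).
Proof.
move=> gC s t st; case: s st (perm_size st) => [|x [|y [|z s]]];
  case: t => [|x' [|y' [|z' t]]] // st _.
have [xx|xNx] := eqVneq x x'.
  by move: st; rewrite xx perm_cons => /perm_mem/(_ y); rewrite !inE eqxx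
    => /esym/eqP ->.
have := perm_mem st x; rewrite !inE eqxx (negPf xNx) => /esym/eqP xy.
have: perm_eq [:: y'; y] [:: y'; x'].
  rewrite xy in st; apply: (perm_trans st).
  by rewrite -[X in perm_eq X]/([:: x'] ++ [:: y']) perm_catC.
rewrite perm_cons => /perm_mem/(_ y); rewrite !inE eqxx => /esym/eqP ->.
by rewrite xy gC.
Qed.

Lemma lie_op_jacobi (L : lieAlgebra) (s : seq L) :
  \sum_(1 <= j < (size s).+1)
    unshuffle_sum s j (fun u v => lie_op (lie_op u :: v)) = 0.
Proof.
have [s3|/eqP s3] := eqVneq (size s) 3%N; last first.
  apply: unshuffle_sum_eq0 => u v suv.
  have [u2|/eqP u2] := eqVneq (size u) 2%N; last first.
    rewrite (lie_op_eq0 u2); case: v {suv} => [|y [|z v]] //.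
    exact: bracket0l.
  by apply: lie_op_eq0 => -[v1]; apply: s3; rewrite -suv u2 v1.
case: s s3 => [|x [|y [|z [|t s]]]] // _.
rewrite unshuffle_sum_size3 /= !addr0 add0r.
rewrite (bracketC (bracket x y)) (bracketC (bracket x z)).
rewrite (bracketC (bracket y z)) (bracketC x z).
by rewrite addrC (addrC (bracket z _)) addrA bracket_jacobi.
Qed.

Lemma lieHom_op_relation (L' L : lieAlgebra) (phi : lieHom L' L) (s : seq L') :
  \sum_(1 <= j < (size s).+1)
    unshuffle_sum s j (fun u v => lieHom_op phi (lie_op u :: v)) =
  Sprime_sum s (fun bs => lie_op (map (lieHom_op phi) bs)).
Proof.
have F0 (bs : seq (seq L')) : size bs <> 2%N ->
    lie_op (map (lieHom_op phi) bs) = 0.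
  by move=> sbs; apply: lie_op_eq0; rewrite size_map.
have [s2|/eqP s2] := eqVneq (size s) 2%N; last first.
  rewrite (@Sprime_sum_eq0 _ _ _ _ 2%N F0) //.
  - apply: unshuffle_sum_eq0 => u [|a v] // suv.
    rewrite lie_op_eq0; first exact: linear0.
    by move=> u2; apply: s2; rewrite -suv u2.
  - case=> [|b1 [|b2 [|b3 bs]]] b // _; rewrite !inE => /orP[] /eqP <-.
      by case: b => [|x [|y b]] // _; exact: bracket0l.
    by case: b => [|x [|y b]] // _; exact: bracket0r.
case: s s2 => [|x [|y [|z s]]] // _.
by rewrite Sprime_sum_size2 // unshuffle_sum_size2 /= !add0r lie_map_bracket.
Qed.

Lemma rep_op_linear (L : lieAlgebra) (M : lieRep L) (s : seq L) :
  linear (@rep_op L M s).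
Proof.
by case: s => [|x [|y s]]; [|exact: act_linear_r|]; exact: linear_cst0.
Qed.

Lemma rep_op0 (L : lieAlgebra) (M : lieRep L) (s : seq L) :
  rep_op s (0 : M) = 0.
Proof. exact: (linear_at0 (@rep_op_linear L M s)). Qed.

Lemma rep_op_relation (L : lieAlgebra) (M : lieRep L) (s : seq L) (m : M) :
  \sum_(1 <= j < (size s).+1)
    unshuffle_sum s j (fun u v => rep_op (lie_op u :: v) m) +
  \sum_(0 <= j < (size s).+1)
    unshuffle_sum s j (fun u v => rep_op v (rep_op u m)) = 0.
Proof.
have [s2|/eqP s2] := eqVneq (size s) 2%N; last first.
  rewrite !unshuffle_sum_eq0 ?addr0 // => u v suv.
    have [u1|/eqP u1] := eqVneq (size u) 1%N; last first.
      by case: u u1 {suv} => [|? [|? ?]] // _; rewrite rep_op0.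
    have [v1|/eqP v1] := eqVneq (size v) 1%N; last first.
      by case: v v1 {suv} => [|? [|? ?]].
    by case: s2; rewrite -suv u1 v1.
  case: v suv => [|? ?] // suv.
  rewrite lie_op_eq0; first exact: act0l.
  by move=> u2; apply: s2; rewrite -suv u2.
case: s s2 => [|x [|y [|z s]]] // _.
rewrite unshuffle_sum_size2 unshuffle_sum_size2' /= !add0r !addr0.
by rewrite act_bracket addrA subrK addvv_F2.
Qed.

Lemma repHom_op_relation (L : lieAlgebra) (M N : lieRep L) (f : repHom M N)
    (s : seq L) (m : M) :
  \sum_(1 <= j < (size s).+1)
    unshuffle_sum s j (fun u v => repHom_op f (lie_op u :: v) m) +
  \sum_(0 <= j < (size s).+1)
    unshuffle_sum s j (fun u v => repHom_op f v (rep_op u m)) =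
  \sum_(0 <= j < (size s).+1)
    unshuffle_sum s j (fun u v => rep_op v (repHom_op f u m)).
Proof.
rewrite [X in X + _]unshuffle_sum_eq0 // add0r.
have [s1|/eqP s1] := eqVneq (size s) 1%N; last first.
  rewrite !unshuffle_sum_eq0 // => u v suv.
    case: u suv => [|? ?] suv; last exact: rep_op0.
    by case: v suv => [|a [|b v]] // suv; case: s1; rewrite -suv.
  case: v suv => [|? ?] // suv.
  case: u suv => [|a [|b u]] suv; try exact: linear0.
  by case: s1; rewrite -suv.
case: s s1 => [|x [|y s]] // _.
by rewrite !unshuffle_sum_size1 /= add0r addr0 rep_map_act.
Qed.

Lemma lie_op_degree (L : lieAlgebra) ds (s : seq (deg0 L)) :
  homogeneous ds s ->
  @grade (deg0 L) (\sum_(d <- ds) d + (size s)%:Z - 2) (@lie_op L s).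
Proof.
case: s => [|x [|y [|z s]]]; try by right.
move=> /homogeneous_cons[d [ds1 [-> dx]]] /homogeneous_cons[e [ds2 [-> ey]]].
move/homogeneous_nil=> ->; rewrite big_cons big_seq1.
case: dx => [->|->]; last by right; exact: bracket0l.
by case: ey => [->|->]; [left | right; exact: bracket0r].
Qed.

Lemma lieHom_op_degree (L' L : lieAlgebra) (phi : lieHom L' L) ds
    (s : seq (deg0 L')) :
  homogeneous ds s ->
  @grade (deg0 L) (\sum_(d <- ds) d + (size s)%:Z - 1) (lieHom_op phi s).
Proof.
case: s => [|x [|y s]]; try by right.
move=> /homogeneous_cons[d [ds1 [-> dx]]] /homogeneous_nil ->.
rewrite big_seq1.
by case: dx => [->|->]; [left | right; exact: linear0].
Qed.

Lemma rep_op_degree (L : lieAlgebra) (M : lieRep L) ds (s : seq (deg0 L))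
    e (m : deg0 M) :
  homogeneous ds s -> grade e m ->
  @grade (deg0 M) (\sum_(d <- ds) d + e + (size s)%:Z - 1) (@rep_op L M s m).
Proof.
case: s => [|x [|y s]]; try by right.
move=> /homogeneous_cons[d [ds1 [-> dx]]] /homogeneous_nil -> em.
rewrite big_seq1; case: dx => [->|->]; last by right; exact: act0l.
by case: em => [->|->]; [left | right; exact: act0r].
Qed.

Lemma repHom_op_degree (L : lieAlgebra) (M N : lieRep L) (f : repHom M N) ds
    (s : seq (deg0 L)) e (m : deg0 M) :
  homogeneous ds s -> grade e m ->
  @grade (deg0 N) (\sum_(d <- ds) d + e + (size s)%:Z) (repHom_op f s m).
Proof.
case: s => [|x s]; last by right.
move=> /homogeneous_nil -> [->|->]; first by left; rewrite big_nil.
by right; exact: linear0.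
Qed.

Definition linf_of_lie (L : lieAlgebra) : linfAlgebra :=
  @LinfAlgebra (deg0 L) (@lie_op L) erefl
    (multilinear_binary (@bracket_linear_r L) (@bracket_linear_l L))
    (symmetric_binary (@bracketC L)) (@lie_op_degree L) (@lie_op_jacobi L).

Definition linfHom_of_lieHom (L' L : lieAlgebra) (phi : lieHom L' L) :
    linfHom (linf_of_lie L') (linf_of_lie L) :=
  @LinfHom (linf_of_lie L') (linf_of_lie L) (lieHom_op phi) erefl
    (multilinear_unary (linearP phi)) (@symmetric_unary _ _ phi)
    (@lieHom_op_degree L' L phi) (@lieHom_op_relation L' L phi).

Definition linfModuleData_of_rep (L : lieAlgebra) (M : lieRep L) :
    linfModuleData (linf_of_lie L) :=
  @LinfModuleData (linf_of_lie L) (deg0 M) (@rep_op L M).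

Lemma linfModule_of_repP (L : lieAlgebra) (M : lieRep L) :
  is_linfModule (linfModuleData_of_rep M).
Proof.
exact: (@IsLinfModule (linf_of_lie L) (linfModuleData_of_rep M)
  (@rep_op_linear L M) (fun m => multilinear_unary (@act_linear_l L M m))
  (fun m => @symmetric_unary _ _ (fun x => act x m))
  (@rep_op_degree L M) (@rep_op_relation L M)).
Qed.

Definition linfModule_of_rep (L : lieAlgebra) (M : lieRep L) :
    linfModule (linf_of_lie L) :=
  LinfModule (linfModule_of_repP M).

Lemma repHom_op_linear (L : lieAlgebra) (M N : lieRep L) (f : repHom M N) s :
  linear (repHom_op f s).
Proof. by case: s => [|x s]; [exact: linearP | exact: linear_cst0]. Qed.

Lemma repHom_op_multilinear (L : lieAlgebra) (M N : lieRep L) (f : repHom M N)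
  m : multilinear ((repHom_op f)^~ m).
Proof. by move=> [|a s1] s2; exact: linear_cst0. Qed.

Lemma repHom_op_symmetric (L : lieAlgebra) (M N : lieRep L) (f : repHom M N)
  m : symmetric_family ((repHom_op f)^~ m).
Proof. by move=> s t /perm_size; case: s => [|x s]; case: t. Qed.

Definition linfModuleHom_of_repHom (L : lieAlgebra) (M N : lieRep L)
    (f : repHom M N) :
    linfModuleHom (linfModule_of_rep M) (linfModule_of_rep N) :=
  @LinfModuleHom (linf_of_lie L) (linfModule_of_rep M) (linfModule_of_rep N)
    (repHom_op f) (@repHom_op_linear L M N f) (@repHom_op_multilinear L M N f)
    (@repHom_op_symmetric L M N f) (@repHom_op_degree L M N f)
    (@repHom_op_relation L M N f).

(* Main.v *)
Require Import Defs.
From mathcomp Require Import all_boot all_fingroup all_algebra.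
From Stdlib Require Import FunctionalExtensionality.

Set Implicit Arguments.
Unset Strict Implicit.
Unset Printing Implicit Defensive.

Import GRing.Theory.
Local Open Scope ring_scope.

(** A term of the restriction formula is indexed by a composition
    [i_1 + ... + i_r = n - 1] and by an unshuffle.  It contains the factor
    [k_(r+1)], which vanishes for [r <> 1] because [M] is a representation, and
    the factors [phi_(i_l)], which vanish for [i_l <> 1] because [phi] is a Lie
    algebra homomorphism.  So a term survives only if [r = 1] and [i_1 = 1],
    that is [n = 2] (the other values of [n] fall under [Sprime_sum_eq0]); there
    the only permutation is the identity and
    [k'_2 (x, m) = k_2 (phi x, m) = phi x . m] ([Sprime_sum_size1]).
    For a homomorphism of representations the factor is [f_(r+1)] with
    [r >= 1], which is always zero, so that only [(phi^* f)_1 = f_1] remains.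

    Structure maps are functions of a sequence and a vector, so their equality
    is obtained from equality of values by functional extensionality. *)

(** Only one term: (1) is the only composition of 1, and the symmetric group on
    one letter is trivial. *)
Lemma Sprime_sum_size1 (V W : lmodType 'F_2) (x : V) (F : seq (seq V) -> W) :
  Sprime_sum [:: x] F = F [:: [:: x]].
Proof.
rewrite /Sprime_sum [size _]/= big_nat1.
pose i0 : 1.-tuple 'I_2 := [tuple ord_max].
rewrite (big_pred1 i0) => [|i]; last first.
  apply/idP/eqP => [/andP[_ /eqP]|-> //].
  case/tupleP: i => a t; rewrite (tuple0 t) /= addn0 => a1.
  by apply/val_inj; congr [:: _]; apply/val_inj.
rewrite (big_pred1 1%g) => [|tau].
  by rewrite /tensor_perm enum_ordSl (size0nil (size_enum_ord 0)) /= perm1.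
have -> : tau = 1%g by apply/permP => j; rewrite !ord1.
rewrite /= eqxx /Sprime /oneline enum_ordSl (size0nil (size_enum_ord 0)) /=.
by apply/forallP => -[].
Qed.

Theorem corollary1 (L' L : lieAlgebra) (phi : lieHom L' L) :
  (forall M : lieRep L,
     restrict (linfHom_of_lieHom phi) (linfModule_of_rep M) =
     kdata (linfModule_of_rep (rep_restrict phi M))) /\
  (forall (M N : lieRep L) (f : repHom M N),
     restrict_hom (linfHom_of_lieHom phi) (linfModuleHom_of_repHom f) =
     fop (linfModuleHom_of_repHom (repHom_restrict phi f))).
Proof.
split=> [M|M N f].
  (* The underlying graded spaces agree definitionally. *)
  congr (@LinfModuleData (linf_of_lie L') (deg0 M) _).
  apply: functional_extensionality => s; apply: functional_extensionality => m.
  case: s => [|x [|y s]] //; first by rewrite Sprime_sum_size1.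
  apply: (@Sprime_sum_eq0 _ _ _ _ 1%N) => // [[|b [|c bs]] //|[|b [|c bs]] // d _].
  rewrite inE => /eqP->; case: b => [|u [|v b]] //= _; exact: act0l.
apply: functional_extensionality => s; apply: functional_extensionality => m.
case: s => [|x s] //.
by apply: (@Sprime_sum_eq0 _ _ _ _ 0%N) => // -[].
Qed.
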